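(* If $X,Y\in\mathbb{M}_n$ are accretive-dissipative, then $$\omega(XY)\le 2\,\omega(X)\,\omega(Y).$$
   Context: $\mathbb{M}_n$ is the algebra of all $n\times n$ complex matrices. For $X\in\mathbb{M}_n$, write $\operatorname{Re}X=\frac{X+X^*}{2}$ and $\operatorname{Im}X=\frac{X-X^*}{2i}$ (both Hermitian). $X$ is accretive-dissipative if both $\operatorname{Re}X$ and $\operatorname{Im}X$ are positive definite. The numerical radius is $\omega(X)=\sup\{|\langle Xx,x\rangle| : x\in\mathbb{C}^n,\ \|x\|=1\}$, with the standard inner product and Euclidean norm on $\mathbb{C}^n$. *)

(* Defs.v *)
From mathcomp Require Import all_boot all_order all_algebra.
From mathcomp Require Import sesquilinear spectral.
From mathcomp Require Import complex.
From mathcomp Require Import classical_sets reals.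

Set Implicit Arguments.
Unset Strict Implicit.
Unset Printing Implicit Defensive.

Import Order.TTheory GRing.Theory Num.Theory.
Local Open Scope ring_scope.
Local Open Scope complex_scope.
Local Open Scope sesquilinear_scope.
Local Open Scope classical_set_scope.

Section NumericalRadius.
Variables (R : realType) (n : nat).
Implicit Types (X : 'M[R[i]]_n) (x y : 'cV[R[i]]_n).

(* [dotmx] is defined on row vectors; here
   cinner x y = \sum_i x i 0 * (y i 0)^*, linear in the first argument. *)
Definition cinner x y : R[i] := dotmx x^T y^T.

Definition cnorm x : R := Num.sqrt (complex.Re (cinner x x)).

Definition mxRe X : 'M[R[i]]_n := 2^-1 *: (X + X ^t* ).

Definition mxIm X : 'M[R[i]]_n := (2 * 'i%C)^-1 *: (X - X ^t* ).

(* In the order of R[i], 0 < z says that z is real and positive. *)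
Definition posdefmx X : Prop :=
  X \is hermsymmx /\ forall x, x != 0 -> 0 < cinner (X *m x) x.

Definition accretive_dissipative X : Prop :=
  posdefmx (mxRe X) /\ posdefmx (mxIm X).

(* The set is bounded, and nonempty unless n = 0, in which case the library
   convention sup set0 = 0 applies. *)
Definition numerical_radius X : R :=
  sup [set Normc.normc (cinner (X *m x) x) | x in [set x | cnorm x = 1]].

End NumericalRadius.

(* Main.v *)
(* Write X = A + iB with A, B positive definite.  Cauchy-Schwarz for the forms
   of A and B gives |<Xx,y>|^2 <= <(A+B)x,x> <(A+B)y,y>, while
   <(A+B)x,x> <= sqrt 2 |<Xx,x>| because (a+b)^2 <= 2 |a+ib|^2.  Hence
   ||X|| <= sqrt 2 w(X), and w(XY) <= ||X|| ||Y|| <= 2 w(X) w(Y). *)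
Require Import Defs.
From mathcomp Require Import all_boot all_order all_algebra.
From mathcomp Require Import sesquilinear spectral.
From mathcomp Require Import complex classical_sets reals.
From mathcomp Require Import ring lra.

Set Implicit Arguments.
Unset Strict Implicit.
Unset Printing Implicit Defensive.

Import Order.TTheory GRing.Theory Num.Theory.
Local Open Scope ring_scope.
Local Open Scope complex_scope.
Local Open Scope sesquilinear_scope.

(* The library states Cauchy-Schwarz for declared dot products only; this
   repackages a positive definite Hermitian form as one. *)
Lemma hermitian_CauchySchwarz (C : numClosedFieldType) (U : vectType C)
    (h : {hermitian U for false & Num.conj}) (u v : U) :
  (forall w, w != 0 -> 0 < h w w) -> `|h u v| ^+ 2 <= h u u * h v v.
Proof.
case: h => h [hB hH] /= hpos.
pose d := Dot.Pack (Dot.Class (isDotProduct.Build _ _ h hpos) hB hH).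
exact: (CauchySchwarz d u v).1.
Qed.

Section NumericalRadiusTheory.
Variables (R : realType) (n : nat).
Implicit Types (A X : 'M[R[i]]_n) (x y : 'cV[R[i]]_n).

(** * Inner products of column vectors and forms of positive definite matrices *)

Lemma cinnerE x y : cinner x y = \sum_i x i 0 * Num.conj (y i 0).
Proof.
by rewrite /cinner dotmxE mxE; apply: eq_bigr => i _; rewrite !mxE.
Qed.

Lemma cinnerDl x y z : cinner (x + y) z = cinner x z + cinner y z.
Proof. by rewrite /cinner linearD linearDl. Qed.

Lemma cinnerZl a x y : cinner (a *: x) y = a * cinner x y.
Proof. by rewrite /cinner linearZ linearZl_LR. Qed.

Lemma cinnerZr a x y : cinner x (a *: y) = Num.conj a * cinner x y.
Proof. by rewrite /cinner linearZ linearZr_LR. Qed.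

Lemma cinner_scale_real (c : R) x y :
  cinner (c%:C *: x) (c%:C *: y) = (c ^+ 2)%:C * cinner x y.
Proof.
rewrite cinnerZl cinnerZr conj_Creal; last by rewrite complex_real.
by rewrite mulrA -rmorphM.
Qed.

Lemma cinner_mul_form A x y :
  cinner (A *m x) y = form_of_matrix Num.conj A^T x^T y^T.
Proof. by rewrite /cinner dotmxE /form_of_matrix trmx_mul trace_mx11. Qed.

Lemma posdefmx_CauchySchwarz A x y : posdefmx A ->
  `|cinner (A *m x) y| ^+ 2 <= cinner (A *m x) x * cinner (A *m y) y.
Proof.
case=> Aherm Apos.
(* Forms act on row vectors, so the form of [A] on columns is carried by [A^T], whose Hermitian
   symmetry comes from that of [A]. *)
have Therm : A^T \is hermsymmx.
  move: Aherm; rewrite !is_hermitianmxE !expr0 !scale1r => /eqP AE.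
  by rewrite {1}AE map_trmx !trmxK.
pose f : 'rV[R[i]]_n -> 'rV[R[i]]_n -> R[i] :=
  form_of_matrix Num.conj (HermitianMx Therm).
have fpos u : u != 0 -> 0 < f u u.
  move=> u0; rewrite -[u]trmxK /f -cinner_mul_form; apply: Apos.
  by rewrite -(inj_eq trmx_inj) trmxK trmx0.
pose H : {hermitian 'rV[R[i]]_n for false & Num.conj} :=
  form_of_matrix Num.conj (HermitianMx Therm).
rewrite !cinner_mul_form.
exact: (@hermitian_CauchySchwarz _ _ H _ _ fpos).
Qed.

Lemma posdefmx_ge0 A x : posdefmx A -> 0 <= cinner (A *m x) x.
Proof.
case=> _ Apos; have [->|x0] := eqVneq x 0; last exact/ltW/Apos.
by rewrite mulmx0 cinnerE big1// => i _; rewrite mxE mul0r.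
Qed.

Lemma cinner_ge0 x : 0 <= cinner x x.
Proof. by rewrite cinnerE sumr_ge0// => i _; rewrite mul_conjC_ge0. Qed.

Lemma mxRe_mxIm X : X = mxRe X + 'i%C *: mxIm X.
Proof.
rewrite /mxRe /mxIm scalerA invfM mulrCA divff ?mulr1; last first.
  by rewrite complexiE neq0Ci.
rewrite -scalerDr addrACA subrr addr0 -mulr2n -(scaler_nat 2 X) scalerA.
by rewrite mulVf ?scale1r// pnatr_eq0.
Qed.

(** * Complex moduli and real inequalities *)

Lemma normcE_norm (z : R[i]) : `|z| = (Normc.normc z)%:C.
Proof. by case: z. Qed.

Lemma normc_ge0 (z : R[i]) : 0 <= Normc.normc z.
Proof. by case: z => a b; exact: sqrtr_ge0. Qed.

Lemma normc_real (c : R) : 0 <= c -> Normc.normc c%:C = c.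
Proof. by move=> c0; rewrite /= expr0n addr0 sqrtr_sqr ger0_norm. Qed.

Lemma complex_ge0P (z : R[i]) : 0 <= z -> exists2 a : R, 0 <= a & z = a%:C.
Proof.
move=> z0; exists (complex.Re z); first by move: z0; rewrite lecE => /andP[].
by rewrite RRe_real// ger0_real.
Qed.

Lemma sqr_normc_rect (a b : R) :
  Normc.normc (a%:C + 'i%C * b%:C) ^+ 2 = a ^+ 2 + b ^+ 2.
Proof.
rewrite /= !(mul0r, mul1r, subr0, addr0, add0r).
by rewrite sqr_sqrtr ?addr_ge0 ?sqr_ge0.
Qed.

(** Cauchy-Schwarz in the plane, for the vectors of square roots of [a], [b] and of [c], [d]. It
    merges the separate estimates for the real and imaginary parts of a matrix. *)
Lemma le_sqr_sum (p q a b c d : R) : 0 <= a -> 0 <= b -> 0 <= c -> 0 <= d ->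
  0 <= p -> 0 <= q -> p ^+ 2 <= a * c -> q ^+ 2 <= b * d ->
  (p + q) ^+ 2 <= (a + b) * (c + d).
Proof.
move=> a0 b0 c0 d0 p0 q0 pac qbd.
suff : 2 * (p * q) <= a * d + b * c by nra.
(* After squaring, this is 4 (ad)(bc) <= (ad + bc)^2, that is, (ad - bc)^2 >= 0. *)
rewrite -ler_sqr ?nnegrE ?addr_ge0 ?mulr_ge0//.
have : p ^+ 2 * q ^+ 2 <= (a * c) * (b * d) by rewrite ler_pM ?sqr_ge0.
have := sqr_ge0 (a * d - b * c).
nra.
Qed.

(* The factors 1 are the norm of a unit vector: simplifying them in the main
   proof makes unification unfold [numerical_radius] without end. *)
Lemma le_sqrt2_trans (a b c d : R) : 0 <= a ->
  d <= Num.sqrt 2 * a * (c * 1) -> c <= Num.sqrt 2 * b * 1 -> d <= 2 * a * b.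
Proof.
rewrite !mulr1 => a0 dc cb; apply: le_trans dc _.
apply: (@le_trans _ _ (Num.sqrt 2 * a * (Num.sqrt 2 * b))).
  by rewrite ler_wpM2l ?mulr_ge0 ?sqrtr_ge0.
by rewrite mulrACA -expr2 sqr_sqrtr// mulrA.
Qed.

Lemma accretive_dissipative_norm_le X x y : accretive_dissipative X ->
  Normc.normc (cinner (X *m x) y) ^+ 2
    <= 2 * (Normc.normc (cinner (X *m x) x) * Normc.normc (cinner (X *m y) y)).
Proof.
(* Replacing [mxRe X] and [mxIm X] by variables keeps unification from
   unfolding them when comparing the two forms. *)
case; have := mxRe_mxIm X.
move: (mxRe X) (mxIm X) => A B XAB XR XI.
have XE z t : cinner (X *m z) t
    = cinner (A *m z) t + 'i%C * cinner (B *m z) t.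
  by rewrite XAB mulmxDl cinnerDl -scalemxAl cinnerZl.
have diag z : exists a b : R, [/\ 0 <= a, 0 <= b,
    cinner (A *m z) z = a%:C, cinner (B *m z) z = b%:C &
    (a + b) ^+ 2 <= 2 * Normc.normc (cinner (X *m z) z) ^+ 2].
  have [a a0 aE] := complex_ge0P (posdefmx_ge0 z XR).
  have [b b0 bE] := complex_ge0P (posdefmx_ge0 z XI).
  exists a, b; split; [exact: a0|exact: b0|exact: aE|exact: bE|].
  rewrite XE aE bE sqr_normc_rect.
  by have := sqr_ge0 (a - b); nra.
have [a [b [a0 b0 aE bE abx]]] := diag x.
have [c [d [c0 d0 cE dE cdy]]] := diag y.
have pac : Normc.normc (cinner (A *m x) y) ^+ 2 <= a * c.
  rewrite -lecR rmorphXn [(a * c)%:C]rmorphM/= -aE -cE -normcE_norm.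
  exact: posdefmx_CauchySchwarz.
have qbd : Normc.normc (cinner (B *m x) y) ^+ 2 <= b * d.
  rewrite -lecR rmorphXn [(b * d)%:C]rmorphM/= -bE -dE -normcE_norm.
  exact: posdefmx_CauchySchwarz.
have pq : Normc.normc (cinner (X *m x) y)
    <= Normc.normc (cinner (A *m x) y) + Normc.normc (cinner (B *m x) y).
  rewrite XE (le_trans (le_normcD _ _))// lerD2l Normc.normcM.
  have -> : Normc.normc 'i%C = 1 :> R.
    by rewrite /Normc.normc expr0n expr1n add0r sqrtr1.
  by rewrite mul1r.
apply: (@le_trans _ _ ((a + b) * (c + d))).
  apply: le_trans (le_sqr_sum a0 b0 c0 d0 (normc_ge0 _) (normc_ge0 _) pac qbd).
  by rewrite ler_sqr// nnegrE ?addr_ge0//; exact: normc_ge0.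
(* [abx] and [cdy] bound squares, so the goal is squared and the resulting 4 is shared out as 2 *
   2. *)
rewrite -ler_sqr ?nnegrE ?mulr_ge0 ?addr_ge0//; try exact: normc_ge0.
rewrite exprMn [leRHS]exprMn [X in _ <= _ * X]exprMn.
have -> (u v : R) : 2 ^+ 2 * (u * v) = (2 * u) * (2 * v) by ring.
exact: ler_pM (sqr_ge0 _) (sqr_ge0 _) abx cdy.
Qed.

(** * Finiteness and homogeneity of the numerical radius *)

Lemma cnorm_cinner x : (cnorm x ^+ 2)%:C = cinner x x.
Proof.
have [a a0 aE] := complex_ge0P (cinner_ge0 x).
by rewrite /cnorm aE sqr_sqrtr.
Qed.

(** Coordinates of a unit vector have modulus at most 1, so the sum of the moduli of all entries of
    [X] serves as bound. This makes the supremum a genuine one. *)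
Lemma cinner_diag_bounded X : exists M : R, forall x, cnorm x = 1 ->
  Normc.normc (cinner (X *m x) x) <= M.
Proof.
have /complex_ge0P[M _ ME] : 0 <= \sum_i \sum_j `|X i j|.
  by apply: sumr_ge0 => i _; apply: sumr_ge0.
exists M => x x1; rewrite -lecR -normcE_norm -ME cinnerE.
have x_le1 i : `|x i 0| <= 1.
  rewrite -(@ler_pXn2r _ 2) ?nnegrE// expr1n.
  have := cnorm_cinner x; rewrite x1 expr1n rmorph1 cinnerE (bigD1 i)//= => ->.
  rewrite -normCK lerDl sumr_ge0// => j _; exact: mul_conjC_ge0.
apply: le_trans (ler_norm_sum _ _ _) _; apply: ler_sum => i _.
rewrite normrM norm_conjC.
apply: (@le_trans _ _ `|(X *m x) i 0|); first by rewrite ler_piMr.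
rewrite mxE; apply: le_trans (ler_norm_sum _ _ _) _; apply: ler_sum => j _.
by rewrite normrM ler_piMr.
Qed.

Lemma numerical_radius_ub X x : cnorm x = 1 ->
  Normc.normc (cinner (X *m x) x) <= numerical_radius X.
Proof.
move=> x1; have [M XM] := cinner_diag_bounded X.
by apply: ub_le_sup; [exists M => _ [y y1 <-]; exact: XM | exists x].
Qed.

(** [0 <= c] covers n = 0, where there is no unit vector and the supremum is 0 by convention. *)
Lemma numerical_radius_le X (c : R) : 0 <= c ->
  (forall x, cnorm x = 1 -> Normc.normc (cinner (X *m x) x) <= c) ->
  numerical_radius X <= c.
Proof.
move=> c0 Xc; rewrite /numerical_radius.
set S := (X in sup X); have [->|/set0P S0] := eqVneq S set0.
  by rewrite sup0.
by apply: ge_sup => // _ [x x1 <-]; exact: Xc.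
Qed.

Lemma numerical_radius_ge0 X : 0 <= numerical_radius X.
Proof.
rewrite /numerical_radius.
set S := (X in sup X); have [->|/set0P[_ [x x1 _]]] := eqVneq S set0.
  by rewrite sup0.
exact: le_trans (normc_ge0 _) (numerical_radius_ub X x1).
Qed.

Lemma normc_cinner_le X x :
  Normc.normc (cinner (X *m x) x) <= numerical_radius X * cnorm x ^+ 2.
Proof.
have [x0|x_neq0] := eqVneq (cnorm x) 0.
  have := cnorm_cinner x; rewrite x0 expr0n /= mulr0 => /esym/eqP.
  rewrite dnorm_eq0 => /eqP/(congr1 trmx); rewrite trmxK trmx0 => ->.
  rewrite mulmx0 cinnerE big1 ?Normc.normc0// => i _.
  by rewrite mxE mul0r.
(* Normalising [x] scales the quadratic form by the inverse square of its norm. *)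
pose u := (cnorm x)^-1%:C *: x.
have u1 : cnorm u = 1.
  rewrite /cnorm cinner_scale_real -cnorm_cinner -rmorphM -exprMn mulVf//.
  by rewrite expr1n /= sqrtr1.
have xE : x = (cnorm x)%:C *: u by rewrite scalerA -rmorphM divff// scale1r.
rewrite [in leLHS]xE -scalemxAr cinner_scale_real Normc.normcM.
rewrite normc_real ?sqr_ge0// mulrC ler_wpM2r ?sqr_ge0//.
exact: numerical_radius_ub.
Qed.

Lemma accretive_dissipative_bound X x y : accretive_dissipative X ->
  Normc.normc (cinner (X *m x) y)
    <= Num.sqrt 2 * numerical_radius X * (cnorm x * cnorm y).
Proof.
move=> Xad; have w0 := numerical_radius_ge0 X.
rewrite -ler_sqr ?nnegrE ?normc_ge0 ?mulr_ge0 ?sqrtr_ge0//.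
apply: le_trans (accretive_dissipative_norm_le x y Xad) _.
rewrite !exprMn sqr_sqrtr// -mulrA ler_pM2l//.
have -> (w a b : R) : w ^+ 2 * (a * b) = (w * a) * (w * b) by ring.
by apply: ler_pM; rewrite ?normc_ge0//; exact: normc_cinner_le.
Qed.

(** Taking [y := X *m x] in the previous bound puts the square of [cnorm (X *m x)] on the left; one
    factor cancels unless it vanishes. *)
Lemma accretive_dissipative_cnorm_le X x : accretive_dissipative X ->
  cnorm (X *m x) <= Num.sqrt 2 * numerical_radius X * cnorm x.
Proof.
move=> /(accretive_dissipative_bound x (X *m x)).
rewrite -cnorm_cinner normc_real ?sqr_ge0// mulrA expr2.
have : 0 <= cnorm (X *m x) by exact: sqrtr_ge0.
rewrite le_eqVlt => /orP[/eqP <- _|X0]; last by rewrite ler_pM2r.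
by rewrite !mulr_ge0 ?numerical_radius_ge0 ?sqrtr_ge0.
Qed.

End NumericalRadiusTheory.

Theorem corollary2p1 (R : realType) (n : nat) (X Y : 'M[R[i]]_n)
    (hX : accretive_dissipative X) (hY : accretive_dissipative Y) :
  numerical_radius (X *m Y) <= 2 * numerical_radius X * numerical_radius Y.
Proof.
apply: numerical_radius_le => [|x x1].
  exact: mulr_ge0 (mulr_ge0 (ler0n _ 2) (numerical_radius_ge0 X))
    (numerical_radius_ge0 Y).
(* The form bound for [X] is applied to the pair [Y *m x], [x], and the norm bound for [Y] to [x];
   each contributes a factor [Num.sqrt 2]. *)
have XYx := accretive_dissipative_bound (Y *m x) x hX.
have Yx := accretive_dissipative_cnorm_le x hY.
rewrite mulmxA x1 in XYx; rewrite x1 in Yx.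
exact: le_sqrt2_trans (numerical_radius_ge0 X) XYx Yx.
Qed.
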